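(* Let $\epsilon\in[0,1]$, $\mathcal N\in\mathrm{CPTP}(AE:B)$ and $\mathcal M\in\mathrm{CP}(AE:B)$. Then $$-\log\beta^{E}_{\epsilon}\big(\mathcal N_{AE\to B}\,\big\|\,\mathcal M_{AE\to B}\big)=D_{\mathrm H,\epsilon}^{\mathrm{mx}}\big(\mathcal N_{AE\to B}\,\big\|\,\mathcal M_{AE\to B}\big).$$
   Context: All quantum systems $A,B,E,R$ have finite-dimensional Hilbert spaces $\mathcal H_A,\mathcal H_B,\dots$. $\mathscr D(\mathcal H)$ is the set of density operators on $\mathcal H$. $\mathrm{CPTP}(AE:B)$ (resp. $\mathrm{CP}(AE:B)$) is the set of completely positive trace-preserving (resp. completely positive) linear maps from operators on $\mathcal H_A\otimes\mathcal H_E$ to operators on $\mathcal H_B$. Such a map applied to an operator on $ARE$ acts as the identity on $R$. Logarithms are taken to a fixed base $>1$, with $-\log 0=+\infty$. Optimal type-II error against a jammer. For $\rho_{AR}\in\mathscr D(\mathcal H_A\otimes\mathcal H_R)$ and a test $0\le M\le I_{BR}$ put $$\alpha(\rho_{AR},M)=\sup_{\sigma_E\in\mathscr D(\mathcal H_E)}\mathrm{tr}\big[\mathcal N_{AE\to B}(\rho_{AR}\otimes\sigma_E)(I-M)\big],\qquad \beta(\rho_{AR},M)=\sup_{\sigma_E\in\mathscr D(\mathcal H_E)}\mathrm{tr}\big[\mathcal M_{AE\to B}(\rho_{AR}\otimes\sigma_E)M\big].$$ Then $$\beta^E_\epsilon(\mathcal N_{AE\to B}\|\mathcal M_{AE\to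 B})=\inf\big\{\beta(\rho_{AR},M):\ \rho_{AR}\in\mathscr D(\mathcal H_A\otimes\mathcal H_R),\ 0\le M\le I_{BR},\ \alpha(\rho_{AR},M)\le\epsilon\big\},$$ where the infimum also ranges over reference systems $R$ of arbitrary dimension. Hypothesis testing divergence. For a density operator $\rho$ and a positive semidefinite operator $\sigma$ on the same space, $D_{\mathrm H,\epsilon}(\rho\|\sigma)=-\log\beta_\epsilon(\rho\|\sigma)$ where $\beta_\epsilon(\rho\|\sigma)=\min\{\mathrm{tr}[\sigma M]:\ 0\le M\le I,\ \mathrm{tr}[\rho(I-M)]\le\epsilon\}$. Its minimax channel divergence is $$D_{\mathrm H,\epsilon}^{\mathrm{mx}}(\mathcal N_{AE\to B}\|\mathcal M_{AE\to B})=\sup_{\rho_{AR}\in\mathscr D(\mathcal H_A\otimes\mathcal H_R)}\ \inf_{\sigma_E,\omega_E\in\mathscr D(\mathcal H_E)}D_{\mathrm H,\epsilon}\big(\mathcal N_{AE\to B}(\rho_{AR}\otimes\sigma_E)\big\|\mathcal M_{AE\to B}(\rho_{AR}\otimes\omega_E)\big),$$ where $R$ is a reference system of arbitrary dimension (also optimized over). *)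

(* Defs.v *)
(* Reals are an arbitrary R : realType of MathComp-Analysis; complex numbers are
   R[i] from mathcomp-real-closed. *)
From HB Require Import structures.
From mathcomp Require Export all_boot all_order all_algebra.
From mathcomp Require Export complex mxtens.
From mathcomp Require Export all_classical all_reals all_analysis.
Set Implicit Arguments.
Unset Strict Implicit.
Unset Printing Implicit Defensive.
Import Order.TTheory GRing.Theory Num.Theory.
Local Open Scope classical_set_scope.
Local Open Scope sesquilinear_scope.
Local Open Scope ring_scope.

(* The operators on a system of dimension n are the matrices 'M[R[i]]_n; the
   dimension of a composite system is the product of the dimensions, its basis
   being indexed as in [tensmx] (notation *t). *)

(* In R[i], 0 <= z means that z is real and nonnegative. *)
Definition psdmx (R : realType) (n : nat) (X : 'M[R[i]]_n) : Prop :=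
  forall v : 'cV[R[i]]_n, 0 <= (v^t* *m X *m v) 0 0.

Definition density (R : realType) (n : nat) : set 'M[R[i]]_n :=
  [set rho | psdmx rho /\ \tr rho = 1].

Definition test (R : realType) (n : nat) : set 'M[R[i]]_n :=
  [set T | psdmx T /\ psdmx (1%:M - T)].

(* The operator (id (x) <k|) X (id (x) |l>) on the first factor. *)
Definition mxslice (R : realType) (m r : nat) (X : 'M[R[i]]_(m * r))
    (k l : 'I_r) : 'M[R[i]]_m :=
  \matrix_(i, j) X (mxtens_index (i, k)) (mxtens_index (j, l)).

(* F (x) id_r, using X = \sum_(k, l) mxslice X k l *t delta_mx k l. *)
Definition ampliation (R : realType) (m n : nat)
    (F : 'M[R[i]]_m -> 'M[R[i]]_n) (r : nat) (X : 'M[R[i]]_(m * r)) :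
    'M[R[i]]_(n * r) :=
  \sum_(k < r) \sum_(l < r) F (mxslice X k l) *t delta_mx k l.

Definition CP (R : realType) (m n : nat)
    (F : {linear 'M[R[i]]_m -> 'M[R[i]]_n}) : Prop :=
  forall (r : nat) (X : 'M[R[i]]_(m * r)), psdmx X -> psdmx (ampliation F X).

Definition CPTP (R : realType) (m n : nat)
    (F : {linear 'M[R[i]]_m -> 'M[R[i]]_n}) : Prop :=
  CP F /\ forall X : 'M[R[i]]_m, \tr (F X) = \tr X.

(* The reordering of tensor factors (A (x) E) (x) R -> (A (x) R) (x) E on basis
   indices. *)
Definition AER_to_ARE (a e r : nat) (i : 'I_(a * e * r)) : 'I_(a * r * e) :=
  let: (ij, k) := mxtens_unindex i in
  let: (x, y) := mxtens_unindex ij in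
  mxtens_index (mxtens_index (x, k), y).

(* F_{AE -> B}(rho_AR (x) sigma_E), an operator on B (x) R. *)
Definition channel_out (R : realType) (a e b : nat)
    (F : {linear 'M[R[i]]_(a * e) -> 'M[R[i]]_b}) (r : nat)
    (rho : 'M[R[i]]_(a * r)) (sigma : 'M[R[i]]_e) : 'M[R[i]]_(b * r) :=
  ampliation F (mxsub (@AER_to_ARE a e r) (@AER_to_ARE a e r) (rho *t sigma)).

(* The traces below are real whenever the operators are positive semidefinite;
   Re only performs the coercion from R[i] to R. *)
Definition alpha (R : realType) (a e b : nat)
    (N : {linear 'M[R[i]]_(a * e) -> 'M[R[i]]_b}) (r : nat)
    (rho : 'M[R[i]]_(a * r)) (T : 'M[R[i]]_(b * r)) : \bar R :=
  ereal_sup [set (complex.Re (\tr (channel_out N rho sigma *m (1%:M - T))))%:E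
            | sigma in @density R e].

Definition beta (R : realType) (a e b : nat)
    (M : {linear 'M[R[i]]_(a * e) -> 'M[R[i]]_b}) (r : nat)
    (rho : 'M[R[i]]_(a * r)) (T : 'M[R[i]]_(b * r)) : \bar R :=
  ereal_sup [set (complex.Re (\tr (channel_out M rho sigma *m T)))%:E
            | sigma in @density R e].

Definition beta_jammer (R : realType) (a e b : nat) (eps : R)
    (N M : {linear 'M[R[i]]_(a * e) -> 'M[R[i]]_b}) : \bar R :=
  ereal_inf [set x | exists (r : nat) (rho : 'M[R[i]]_(a * r))
                            (T : 'M[R[i]]_(b * r)),
    [/\ density rho, test T, (alpha N rho T <= eps%:E)%E & x = beta M rho T]].

(* Base-c logarithm on [0, +oo], with value -oo at 0. *)
Definition elog (R : realType) (c : R) (x : \bar R) : \bar R :=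
  (lne x * ((ln c)^-1)%:E)%E.

(* The minimum is attained, the feasible set being compact and nonempty. *)
Definition beta_state (R : realType) (n : nat) (eps : R)
    (rho sigma : 'M[R[i]]_n) : \bar R :=
  ereal_inf [set (complex.Re (\tr (sigma *m T)))%:E
            | T in [set T | test T /\ complex.Re (\tr (rho *m (1%:M - T))) <= eps]].

Definition DH (R : realType) (c : R) (n : nat) (eps : R)
    (rho sigma : 'M[R[i]]_n) : \bar R :=
  (- elog c (beta_state eps rho sigma))%E.

Definition DH_minimax (R : realType) (c : R) (a e b : nat) (eps : R)
    (N M : {linear 'M[R[i]]_(a * e) -> 'M[R[i]]_b}) : \bar R :=
  ereal_sup [set x | exists (r : nat) (rho : 'M[R[i]]_(a * r)),
    density rho /\
    x = ereal_inf [set y | exists sigma omega : 'M[R[i]]_e,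
          [/\ density sigma, density omega
            & y = DH c eps (channel_out N rho sigma)
                           (channel_out M rho omega)]]].

(* Main.v *)
(* For fixed R and rho, the claim is that the constrained minimax over tests T
   and jammer states agrees with the maximin.  Let v be the maximin value.  For
   densities sigma, omega there is a test T with error at most eps against sigma
   and value at most v + d against omega; rescaling (sigma, omega) to arbitrary
   positive semidefinite (A, B) makes this an oracle which always returns a test
   whose pair of violation operators (X_T, Y_T) on E has nonpositive inner
   product with (A, B).  Querying the oracle repeatedly with the positive part of
   the accumulated violations and averaging the answers (Blackwell
   approachability) yields one test whose violations against all sigma and omega
   are arbitrarily small.  If eps > 0, mixing this test with the identity restores
   the error constraint exactly; if eps = 0, the constraint against all sigma is
   equivalent to the one against the maximally mixed state, and the oracle
   satisfies it exactly. *)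
From HB Require Import structures.
Require Import Defs.
From mathcomp Require Import ring lra.
Import Order.TTheory GRing.Theory Num.Theory.
Local Open Scope classical_set_scope.
Local Open Scope sesquilinear_scope.
Local Open Scope ring_scope.
Set Implicit Arguments.
Unset Strict Implicit.
Unset Printing Implicit Defensive.

(** * Positive semidefinite matrices *)

Lemma adjmxM (C : numClosedFieldType) (m n p : nat) (A : 'M[C]_(m, n)) (B : 'M[C]_(n, p)) :
  (A *m B)^t* = B^t* *m A^t*.
Proof. by rewrite trmx_mul map_mxM. Qed.

Lemma psdmx_gram (R : realType) (m n : nat) (B : 'M[R[i]]_(m, n)) : psdmx (B^t* *m B).
Proof.
move=> v; rewrite mulmxA -adjmxM -mulmxA mxE sumr_ge0 // => i _.
by rewrite !mxE mulrC mul_conjC_ge0.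
Qed.

(** The last clause lets sign and reality of the quadratic form pass to the eigenvalues. *)
Lemma normalmx_spectral (C : numClosedFieldType) (n : nat) (A : 'M[C]_n) :
  A \is normalmx ->
  exists (U : 'M[C]_n) (d : 'rV[C]_n),
    [/\ U *m U^t* = 1%:M, A = U^t* *m diag_mx d *m U
      & forall i, d 0 i = ((U^t* *m (delta_mx i 0 : 'cV[C]_n))^t* *m A *m
                           (U^t* *m (delta_mx i 0 : 'cV[C]_n))) 0 0].
Proof.
move=> /orthomx_spectralP AE.
have U1 := unitarymxP (spectral_unitarymx A).
exists (spectralmx A), (spectral_diag A).
rewrite invmx_unitary ?spectral_unitarymx // in AE.
split=> // i; set U := spectralmx A in U1 AE *; set d := spectral_diag A in AE *.
rewrite adjmxM trmxCK AE; set w : 'cV[C]_n := delta_mx i 0.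
rewrite -!mulmxA (mulmxA U (U^t*) w) U1 mul1mx (mulmxA U (U^t*)) U1 mul1mx.
by rewrite /w trmx_delta map_delta_mx -colE -rowE !mxE eqxx mulr1n.
Qed.

(* X^t* - X is skew-Hermitian, hence diagonalizable, with zero eigenvalues. *)
Lemma psdmx_adj (R : realType) (n : nat) (X : 'M[R[i]]_n) : psdmx X -> X^t* = X.
Proof.
move=> X0; pose Y : 'M[R[i]]_n := X^t* - X.
have YE : Y^t* = - Y by rewrite /Y linearB map_mxB trmxCK opprB.
have YN : Y \is normalmx.
  by apply/normalmxP; rewrite YE mulmxN mulNmx.
have [U [d [U1 UE dE]]] := normalmx_spectral YN.
suff d0 : d = 0 by apply/eqP; rewrite -subr_eq0 -/Y UE d0 linear0 mulmx0 mul0mx.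
apply/rowP => i; rewrite dE [RHS]mxE.
move: (U^t* *m _) => v; have := X0 v; move/ger0_real/CrealP.
have -> : ((v^t* *m X *m v) 0 0)^* = ((v^t* *m X^t* *m v) 0 0).
  have -> : v^t* *m X^t* *m v = (v^t* *m X *m v)^t*.
    by rewrite !adjmxM trmxCK mulmxA.
  by rewrite !mxE.
by move=> e; rewrite mulmxBr mulmxBl mxE [X in _ + X]mxE e subrr.
Qed.

Lemma diag_mx_gram (C : numClosedFieldType) (n : nat) (d : 'rV[C]_n) :
  (forall i, 0 <= d 0 i) ->
  diag_mx d = (diag_mx (map_mx sqrtC d))^t* *m diag_mx (map_mx sqrtC d).
Proof.
move=> d0; rewrite tr_diag_mx map_diag_mx mulmx_diag; congr diag_mx.
by apply/rowP => i; rewrite !mxE /= geC0_conj ?sqrtC_ge0 // -expr2 sqrtCK.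
Qed.

Lemma psdmx_diag (R : realType) (n : nat) (U : 'M[R[i]]_n) (d : 'rV[R[i]]_n) :
  (forall i, 0 <= d 0 i) -> psdmx (U^t* *m diag_mx d *m U).
Proof.
move=> d0; rewrite diag_mx_gram // mulmxA -adjmxM -mulmxA. exact: psdmx_gram.
Qed.

Lemma psdmx_spectral (R : realType) (n : nat) (X : 'M[R[i]]_n) : psdmx X ->
  exists (U : 'M[R[i]]_n) (d : 'rV[R[i]]_n),
    [/\ U *m U^t* = 1%:M, X = U^t* *m diag_mx d *m U & forall i, 0 <= d 0 i].
Proof.
move=> X0.
have [|U [d [U1 XE dE]]] := @normalmx_spectral _ _ X.
  by apply/normalmxP; rewrite psdmx_adj.
by exists U, d; split => // i; rewrite dE; exact: X0.
Qed.

Lemma psdmx_gramP (R : realType) (n : nat) (X : 'M[R[i]]_n) :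
  psdmx X -> exists B : 'M[R[i]]_n, X = B^t* *m B.
Proof.
move=> /psdmx_spectral[U [d [U1 XE d0]]]; exists (diag_mx (map_mx sqrtC d) *m U).
by rewrite XE adjmxM -!mulmxA [in RHS](mulmxA _ _ U) -diag_mx_gram.
Qed.

Definition ip (R : realType) (m n : nat) (A : 'M[R[i]]_(m, n)) (B : 'M[R[i]]_(n, m)) : R :=
  complex.Re (\tr (A *m B)).

Lemma ipC (R : realType) (m n : nat) (A : 'M[R[i]]_(m, n)) (B : 'M[R[i]]_(n, m)) :
  ip A B = ip B A.
Proof. by rewrite /ip mxtrace_mulC. Qed.

Lemma ReD (R : realType) (x y : R[i]) : complex.Re (x + y) = complex.Re x + complex.Re y.
Proof. by case: x y => [? ?] []. Qed.
Lemma ReZ (R : realType) (a : R) (x : R[i]) : complex.Re ((a%:C)%C * x) = a * complex.Re x.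
Proof. by case: x => [? ?] /=; rewrite mul0r subr0. Qed.

(** For [A = P^t* P] and [B = Q^t* Q], cyclicity turns the trace into the squared Frobenius norm of
    [P Q^t*]. *)
Lemma mxtrace_psd_ge0 (R : realType) (n : nat) (A B : 'M[R[i]]_n) :
  psdmx A -> psdmx B -> 0 <= \tr (A *m B).
Proof.
move=> /psdmx_gramP[P ->] /psdmx_gramP[Q ->].
rewrite -mulmxA mxtrace_mulC.
have -> : P *m (Q^t* *m Q) *m P^t* = (P *m Q^t*) *m (P *m Q^t*)^t*.
  by rewrite adjmxM trmxCK !mulmxA.
apply: sumr_ge0 => i _; rewrite mxE sumr_ge0 // => j _.
by rewrite !mxE mul_conjC_ge0.
Qed.

Lemma ip_psd_ge0 (R : realType) (n : nat) (A B : 'M[R[i]]_n) :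
  psdmx A -> psdmx B -> 0 <= ip A B.
Proof. by move=> A0 B0; have := mxtrace_psd_ge0 A0 B0; rewrite lecE => /andP[]. Qed.

Lemma ipDl (R : realType) (m n : nat) (A B : 'M[R[i]]_(m, n)) (X : 'M[R[i]]_(n, m)) :
  ip (A + B) X = ip A X + ip B X.
Proof. by rewrite /ip mulmxDl linearD ReD. Qed.

Lemma ipDr (R : realType) (m n : nat) (A B : 'M[R[i]]_(m, n)) (X : 'M[R[i]]_(n, m)) :
  ip X (A + B) = ip X A + ip X B.
Proof. by rewrite !(ipC X) ipDl. Qed.

Lemma ipZl (R : realType) (m n : nat) (a : R) (A : 'M[R[i]]_(m, n)) (X : 'M[R[i]]_(n, m)) :
  ip ((a%:C)%C *: A) X = a * ip A X.
Proof. by rewrite /ip -scalemxAl linearZ /= ReZ. Qed.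

Lemma ipZr (R : realType) (m n : nat) (a : R) (A : 'M[R[i]]_(m, n)) (X : 'M[R[i]]_(n, m)) :
  ip X ((a%:C)%C *: A) = a * ip X A.
Proof. by rewrite !(ipC X) ipZl. Qed.

Lemma ipNl (R : realType) (m n : nat) (A : 'M[R[i]]_(m, n)) (X : 'M[R[i]]_(n, m)) :
  ip (- A) X = - ip A X.
Proof. by apply/eqP; rewrite -addr_eq0 -ipDl addNr /ip mul0mx linear0. Qed.

Lemma ipNr (R : realType) (m n : nat) (A : 'M[R[i]]_(m, n)) (X : 'M[R[i]]_(n, m)) :
  ip X (- A) = - ip X A.
Proof. by rewrite !(ipC X) ipNl. Qed.

Definition ip_lin := (ipDl, ipDr, ipNl, ipNr, ipZl, ipZr).

Lemma ip0l (R : realType) (m n : nat) (X : 'M[R[i]]_(n, m)) : ip (0 : 'M[R[i]]_(m, n)) X = 0.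
Proof. by rewrite /ip mul0mx linear0. Qed.

Lemma ip11 (R : realType) (n : nat) : ip (1%:M : 'M[R[i]]_n) 1%:M = n%:R.
Proof. by rewrite /ip mul1mx mxtrace1 -(rmorph_nat (real_complex R)). Qed.

Lemma psdmx0 (R : realType) (n : nat) : psdmx (0 : 'M[R[i]]_n).
Proof. by move=> v; rewrite mulmx0 mul0mx mxE. Qed.

Lemma psdmx1 (R : realType) (n : nat) : psdmx (1%:M : 'M[R[i]]_n).
Proof. by have := @psdmx_gram R n n 1%:M; rewrite trmx1 map_mx1 mulmx1. Qed.

Lemma psdmxD (R : realType) (n : nat) (X Y : 'M[R[i]]_n) :
  psdmx X -> psdmx Y -> psdmx (X + Y).
Proof. by move=> X0 Y0 v; rewrite mulmxDr mulmxDl mxE addr_ge0. Qed.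

Lemma psdmxZ (R : realType) (n : nat) (a : R) (X : 'M[R[i]]_n) :
  0 <= a -> psdmx X -> psdmx ((a%:C)%C *: X).
Proof.
by move=> a0 X0 v; rewrite -scalemxAr -scalemxAl mxE mulr_ge0 ?ler0c.
Qed.

Lemma ip_sqr_ge0 (R : realType) (n : nat) (X : 'M[R[i]]_n) : X^t* = X -> 0 <= ip X X.
Proof.
move=> XE; suff -> : ip X X = ip (X^t* *m X) 1%:M.
  by apply: ip_psd_ge0; [exact: psdmx_gram|exact: psdmx1].
by rewrite /ip mulmx1 XE.
Qed.

(** [P] is the positive part and [P - X] the negative part; their product vanishes, so
    [ip X X = ip P P + ip (P - X) (P - X)]. *)
Lemma psdmx_pos_part (R : realType) (n : nat) (X : 'M[R[i]]_n) : X^t* = X ->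
  exists P : 'M[R[i]]_n, [/\ psdmx P, psdmx (P - X) & ip P P <= ip X X].
Proof.
move=> Xh.
have [|U [d [U1 XE dE]]] := @normalmx_spectral _ _ X.
  by apply/normalmxP; rewrite Xh.
have dr i : d 0 i \is Num.real.
  rewrite dE; move: (U^t* *m _) => v; apply/CrealP.
  have {2}-> : v^t* *m X *m v = (v^t* *m X *m v)^t*.
    by rewrite !adjmxM trmxCK Xh mulmxA.
  by rewrite [in RHS]mxE [in RHS]mxE.
(* Positive and negative parts of the real spectrum, written with norms because the order of [R[i]]
   is only partial. *)
pose p : 'rV[R[i]]_n := \row_i ((`|d 0 i| + d 0 i) / 2).
pose q : 'rV[R[i]]_n := \row_i ((`|d 0 i| - d 0 i) / 2).
pose P := U^t* *m diag_mx p *m U; pose Q := U^t* *m diag_mx q *m U.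
have P0 : psdmx P.
  by apply: psdmx_diag => i; rewrite mxE divr_ge0 // -lerBlDr sub0r -normrN real_ler_norm // rpredN.
have Q0 : psdmx Q.
  by apply: psdmx_diag => i; rewrite mxE divr_ge0 // subr_ge0 real_ler_norm.
have XPQ : X = P - Q.
  have dpq : diag_mx d = diag_mx p - diag_mx q.
    apply/matrixP => i j; rewrite !mxE -mulrnBl; congr (_ *+ _).
    by set a := `|_|; set b := d 0 i; field.
  by rewrite XE dpq mulmxBr mulmxBl.
have PQ : P *m Q = 0.
  rewrite /P /Q -!mulmxA (mulmxA U) U1 mul1mx (mulmxA (diag_mx p)) mulmx_diag.
  suff -> : \row_j (p 0 j * q 0 j) = 0 by rewrite linear0 mul0mx mulmx0.
  apply/rowP => i; rewrite !mxE.
  have -> : (`|d 0 i| + d 0 i) / 2 * ((`|d 0 i| - d 0 i) / 2) =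
      (`|d 0 i| ^+ 2 - d 0 i ^+ 2) / 4 by field.
  by rewrite real_normK // subrr mul0r.
have PQ0 : ip P Q = 0 by rewrite /ip PQ linear0.
clear XE; clearbody P Q; subst X; exists P; split; rewrite ?subKr //.
have := ip_psd_ge0 Q0 Q0.
by rewrite !ip_lin (ipC Q P) PQ0; lra.
Qed.

(** The eigenvalues are nonnegative with sum 1, so none exceeds 1. *)
Lemma density_le1 (R : realType) (n : nat) (s : 'M[R[i]]_n) : density s -> psdmx (1%:M - s).
Proof.
move=> [/psdmx_spectral[U [d [U1 -> d0]]] tr1].
have sd : \sum_i d 0 i = 1.
  by rewrite -tr1 -mulmxA mxtrace_mulC -mulmxA U1 mulmx1 mxtrace_diag.
have -> : 1%:M - U^t* *m diag_mx d *m U = U^t* *m diag_mx (const_mx 1 - d) *m U.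
  have -> : diag_mx (const_mx 1 - d) = 1%:M - diag_mx d.
    by apply/matrixP => i j; rewrite !mxE mulrnBl.
  by rewrite mulmxBr mulmxBl mulmx1 (mulmx1C U1).
apply: psdmx_diag => i; rewrite !mxE subr_ge0 -sd (bigD1 i) //= lerDl.
by apply: sumr_ge0.
Qed.

(** * Approachability *)

(* A and B dominate k.+1 times the averaged violations X and Y, and their squared
   norm grows only linearly in k: replacing A + X by its positive part does not
   increase the norm, and the cross terms ip A X + ip B Y are nonpositive. *)
Lemma approachability (R : realType) (n : nat)
    (K : 'M[R[i]]_n -> 'M[R[i]]_n -> Prop) (D : R) :
  (forall X Y X' Y' (t u : R), 0 <= t -> 0 <= u -> t + u = 1 -> K X Y -> K X' Y' ->
     K ((t%:C)%C *: X + (u%:C)%C *: X') ((t%:C)%C *: Y + (u%:C)%C *: Y')) ->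
  (forall X Y, K X Y -> [/\ X^t* = X, Y^t* = Y & ip X X + ip Y Y <= D]) ->
  (forall A B, psdmx A -> psdmx B ->
     exists X Y, K X Y /\ ip A X + ip B Y <= 0) ->
  forall k : nat, exists X Y A B,
    [/\ K X Y, psdmx A /\ psdmx B,
        psdmx (A - ((k.+1%:R : R)%:C)%C *: X), psdmx (B - ((k.+1%:R : R)%:C)%C *: Y)
      & ip A A + ip B B <= k.+1%:R * D].
Proof.
move=> Kconv Kbnd Korc.
have step A B X Y : psdmx A -> psdmx B -> K X Y -> ip A X + ip B Y <= 0 ->
    exists A' B', [/\ psdmx A', psdmx B', psdmx (A' - (A + X)), psdmx (B' - (B + Y))
      & ip A' A' + ip B' B' <= ip A A + ip B B + D].
  move=> A0 B0 KXY le0; have [Xh Yh bd] := Kbnd _ _ KXY.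
  have [|A' [A'0 A'1 A'2]] := @psdmx_pos_part _ _ (A + X).
    by rewrite linearD map_mxD Xh psdmx_adj.
  have [|B' [B'0 B'1 B'2]] := @psdmx_pos_part _ _ (B + Y).
    by rewrite linearD map_mxD Yh psdmx_adj.
  exists A', B'; split=> //; move: A'2 B'2.
  by rewrite !ip_lin (ipC X A) (ipC Y B); lra.
elim=> [|k [X [Y [A [B [KXY [A0 B0] AX BY le]]]]]].
  have [X [Y [KXY le0]]] := Korc 0 0 (@psdmx0 _ _) (@psdmx0 _ _).
  have [A [B [A0 B0]]] := step _ _ _ _ (@psdmx0 _ _) (@psdmx0 _ _) KXY le0.
  rewrite !add0r !ip0l => AX BY le; exists X, Y, A, B.
  by rewrite !scale1r; split; [exact: KXY|split|exact: AX|exact: BY|lra].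
have [X1 [Y1 [KXY1 le0]]] := Korc A B A0 B0.
have [A' [B' [A'0 B'0 A'1 B'1 le']]] := step _ _ _ _ A0 B0 KXY1 le0.
(* Weights of a running average: [k.+2] times the new average is [k.+1] times the old one plus the
   new violation. *)
pose u : R := (k.+2%:R)^-1; pose t : R := k.+1%:R * u.
have k2 : (k.+2%:R : R) != 0 by rewrite pnatr_eq0.
have k2t : k.+2%:R * t = k.+1%:R :> R by rewrite /t mulrCA mulfV // mulr1.
have k2u : k.+2%:R * u = 1 :> R by rewrite mulfV.
have comb (Z Z1 W W' : 'M[R[i]]_n) :
    psdmx (W - ((k.+1%:R : R)%:C)%C *: Z) -> psdmx (W' - (W + Z1)) ->
    psdmx (W' - ((k.+2%:R : R)%:C)%C *: ((t%:C)%C *: Z + (u%:C)%C *: Z1)).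
  move=> p1 p2; have := psdmxD p1 p2; congr psdmx.
  rewrite scalerDr !scalerA -!rmorphM /= k2t k2u scale1r !opprD.
  by rewrite [LHS]addrC -addrA addrACA addNr add0r (addrC (- Z1)).
exists ((t%:C)%C *: X + (u%:C)%C *: X1), ((t%:C)%C *: Y + (u%:C)%C *: Y1), A', B'.
split.
- apply: Kconv KXY KXY1; rewrite ?mulr_ge0 ?invr_ge0 ?ler0n //.
  by rewrite /t -[X in _ + X]mul1r -mulrDl natr1 mulfV.
- by split.
- exact: comb AX A'1.
- exact: comb BY B'1.
- rewrite -[k.+2%:R]natr1 mulrDl mul1r; lra.
Qed.

(** Since [s] is below the identity, [ip s W <= ip 1%:M W]; the squared norm of [W - a 1] being
    nonnegative bounds [2 a ip 1%:M W]. *)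
Lemma ip_density_le (R : realType) (n : nat) (s W : 'M[R[i]]_n) (a : R) :
  0 <= a -> density s -> psdmx W -> 2 * a * ip s W <= ip W W + a ^+ 2 * n%:R.
Proof.
move=> a0 /density_le1 s1 W0.
have := ip_psd_ge0 s1 W0; rewrite !ip_lin => le1.
have : 0 <= ip (W - (a%:C)%C *: 1%:M) (W - (a%:C)%C *: 1%:M).
  apply: ip_sqr_ge0.
  rewrite linearB map_mxB psdmx_adj //; congr (_ - _).
  rewrite linearZ /= map_mxZ trmx1 map_mx1; congr (_ *: _).
  by apply: geC0_conj; rewrite ler0c.
rewrite !ip_lin ip11 (ipC W 1%:M) => le2.
have : a * ip s W <= a * ip 1%:M W by apply: ler_wpM2l => //; lra.
nra.
Qed.

(** After [k] rounds the dominating matrices have squared norm of order [k], so their pairing with a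
    density is of order [sqrt k]; dividing by [k] leaves arbitrarily small violations. *)
Lemma approach_density (R : realType) (n : nat)
    (K : 'M[R[i]]_n -> 'M[R[i]]_n -> Prop) (D : R) :
  (0 < n)%N ->
  (forall X Y X' Y' (t u : R), 0 <= t -> 0 <= u -> t + u = 1 -> K X Y -> K X' Y' ->
     K ((t%:C)%C *: X + (u%:C)%C *: X') ((t%:C)%C *: Y + (u%:C)%C *: Y')) ->
  (forall X Y, K X Y -> [/\ X^t* = X, Y^t* = Y & ip X X + ip Y Y <= D]) ->
  (forall A B, psdmx A -> psdmx B ->
     exists X Y, K X Y /\ ip A X + ip B Y <= 0) ->
  forall d : R, 0 < d -> exists X Y, K X Y /\
    forall s, density s -> ip s X <= d /\ ip s Y <= d.
Proof.
move=> n0 Kconv Kbnd Korc d d0.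
(* [ip_density_le] at a = k d / n gives ip s (k X) <= k d once D n <= k d^2. *)
pose k := Num.truncn (D * n%:R / d ^+ 2).
have kD : D * n%:R <= k.+1%:R * d ^+ 2.
  rewrite -ler_pdivrMr ?exprn_gt0 //.
  by rewrite ltW // truncnS_gt.
have [X [Y [A [B [KXY [A0 B0] AX BY le]]]]] := approachability Kconv Kbnd Korc k.
exists X, Y; split=> // s sd.
have n0' : 0 < n%:R :> R by rewrite ltr0n.
have k0 : 0 < k.+1%:R :> R by rewrite ltr0n.
move: (k.+1%:R : R) AX BY le kD k0 => h AX BY le kD h0.
have key W Z : psdmx W -> psdmx (W - (h%:C)%C *: Z) -> ip W W <= h * D -> ip s Z <= d.
  move=> W0 WZ leW.
  have a0 : 0 <= h * d / n%:R by rewrite !mulr_ge0 ?invr_ge0 ?ltW.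
  have := ip_density_le a0 sd W0.
  have := ip_psd_ge0 sd.1 WZ; rewrite !ip_lin => le1 le2.
  have : 2 * (h * d / n%:R) * ip s W <= h * D + (h * d / n%:R) ^+ 2 * n%:R by lra.
  rewrite -(ler_pM2r n0').
  have -> : 2 * (h * d / n%:R) * ip s W * n%:R = h * (2 * d * ip s W).
    by field; rewrite gt_eqF.
  have -> : (h * D + (h * d / n%:R) ^+ 2 * n%:R) * n%:R = h * (D * n%:R + h * d ^+ 2).
    by field; rewrite gt_eqF.
  rewrite ler_pM2l // => le3.
  have : d * (2 * h * ip s Z) <= d * (2 * h * d).
    apply: (@le_trans _ _ (d * (2 * ip s W))); first by apply: ler_wpM2l; lra.
    by rewrite (_ : d * (2 * h * d) = 2 * (h * d ^+ 2)); [lra|ring].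
  by rewrite !(ler_pM2l, ler_pM2r, mulr_gt0).
(* Both squared norms are nonnegative, so the bound on their sum bounds each. *)
have := ip_sqr_ge0 (psdmx_adj A0); have := ip_sqr_ge0 (psdmx_adj B0) => ? ?.
by split; [apply: key AX _ | apply: key BY _] => //; lra.
Qed.

(** * Channels and their adjoints *)

Lemma channel_out_is_linear (R : realType) (a e b : nat)
    (F : {linear 'M[R[i]]_(a * e) -> 'M[R[i]]_b}) (r : nat) (rho : 'M[R[i]]_(a * r)) :
  linear (channel_out F rho).
Proof.
move=> c s s'; rewrite /channel_out /ampliation scaler_sumr -big_split /=.
apply: eq_bigr => k _; rewrite scaler_sumr -big_split /=; apply: eq_bigr => l _.
set X := mxsub _ _ _; set Y := mxsub _ _ _; set Z := mxsub _ _ _.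
have -> : mxslice X k l = c *: mxslice Y k l + mxslice Z k l.
  by apply/matrixP => i j; rewrite !mxE mulrDr mulrCA.
rewrite linearP; apply/matrixP => i j; rewrite !mxE mulrDl; congr (_ + _).
by rewrite mulrA.
Qed.

HB.instance Definition _ (R : realType) (a e b : nat)
    (F : {linear 'M[R[i]]_(a * e) -> 'M[R[i]]_b}) (r : nat) (rho : 'M[R[i]]_(a * r)) :=
  GRing.isLinear.Build R[i] 'M[R[i]]_e 'M[R[i]]_(b * r) *:%R (channel_out F rho)
    (channel_out_is_linear F rho).

Lemma psdmx_tens (R : realType) (m n : nat) (X : 'M[R[i]]_m) (Y : 'M[R[i]]_n) :
  psdmx X -> psdmx Y -> psdmx (X *t Y).
Proof.
move=> /psdmx_gramP[P ->] /psdmx_gramP[Q ->].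
by rewrite -tensmx_mul -map_mxT -trmx_tens; exact: psdmx_gram.
Qed.

Lemma psdmx_mxsub (R : realType) (m n : nat) (f : 'I_m -> 'I_n) (X : 'M[R[i]]_n) :
  psdmx X -> psdmx (mxsub f f X).
Proof.
move=> /psdmx_gramP[P ->].
have -> : mxsub f f (P^t* *m P) = (colsub f P)^t* *m colsub f P.
  by apply/matrixP => i j; rewrite !mxE; apply: eq_bigr => k _; rewrite !mxE.
exact: psdmx_gram.
Qed.

Lemma psdmx_channel_out (R : realType) (a e b : nat)
    (F : {linear 'M[R[i]]_(a * e) -> 'M[R[i]]_b}) (r : nat)
    (rho : 'M[R[i]]_(a * r)) (s : 'M[R[i]]_e) :
  CP F -> psdmx rho -> psdmx s -> psdmx (channel_out F rho s).
Proof. by move=> F0 rho0 s0; apply/F0/psdmx_mxsub/psdmx_tens. Qed.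

(* The Hilbert-Schmidt adjoint of [channel_out F rho]. *)
Definition channel_adj (R : realType) (a e b : nat)
    (F : {linear 'M[R[i]]_(a * e) -> 'M[R[i]]_b}) (r : nat)
    (rho : 'M[R[i]]_(a * r)) (T : 'M[R[i]]_(b * r)) : 'M[R[i]]_e :=
  \matrix_(i, j) \tr (channel_out F rho (delta_mx j i) *m T).

Lemma channel_adj_is_linear (R : realType) (a e b : nat)
    (F : {linear 'M[R[i]]_(a * e) -> 'M[R[i]]_b}) (r : nat) (rho : 'M[R[i]]_(a * r)) :
  linear (channel_adj F rho).
Proof.
move=> c T T'; apply/matrixP => i j.
by rewrite !mxE mulmxDr -scalemxAr linearP.
Qed.

HB.instance Definition _ (R : realType) (a e b : nat)
    (F : {linear 'M[R[i]]_(a * e) -> 'M[R[i]]_b}) (r : nat) (rho : 'M[R[i]]_(a * r)) :=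
  GRing.isLinear.Build R[i] 'M[R[i]]_(b * r) 'M[R[i]]_e *:%R (channel_adj F rho)
    (channel_adj_is_linear F rho).

(** Expand [s] in matrix units; the swapped indices in [channel_adj] match the trace of a
    product. *)
Lemma mxtrace_channel_adj (R : realType) (a e b : nat)
    (F : {linear 'M[R[i]]_(a * e) -> 'M[R[i]]_b}) (r : nat)
    (rho : 'M[R[i]]_(a * r)) (s : 'M[R[i]]_e) (T : 'M[R[i]]_(b * r)) :
  \tr (s *m channel_adj F rho T) = \tr (channel_out F rho s *m T).
Proof.
rewrite [in RHS](matrix_sum_delta s) linear_sum mulmx_suml linear_sum.
apply: eq_bigr => i _; rewrite mxE linear_sum mulmx_suml linear_sum.
apply: eq_bigr => j _.
by rewrite /= linearZ /= -scalemxAl linearZ /= mxE.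
Qed.

(** The quadratic form at [v] is the pairing with [v *m v^t*], which duality moves to the output
    side, where complete positivity applies. *)
Lemma psdmx_channel_adj (R : realType) (a e b : nat)
    (F : {linear 'M[R[i]]_(a * e) -> 'M[R[i]]_b}) (r : nat)
    (rho : 'M[R[i]]_(a * r)) (T : 'M[R[i]]_(b * r)) :
  CP F -> psdmx rho -> psdmx T -> psdmx (channel_adj F rho T).
Proof.
move=> F0 rho0 T0 v.
have -> : (v^t* *m channel_adj F rho T *m v) 0 0 = \tr (v *m v^t* *m channel_adj F rho T).
  by rewrite -trace_mx11 mxtrace_mulC mulmxA.
rewrite mxtrace_channel_adj; apply: mxtrace_psd_ge0 => //.
apply: psdmx_channel_out => //.
by have := @psdmx_gram R 1 e (v^t*); rewrite trmxCK.
Qed.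

(** * Minimax over tests *)

Lemma density_delta (R : realType) (n : nat) (k : 'I_n) :
  density (delta_mx k k : 'M[R[i]]_n).
Proof.
split.
  have -> : delta_mx k k = (delta_mx ord0 k : 'M[R[i]]_(1, n))^t* *m delta_mx ord0 k.
    by rewrite trmx_delta map_delta_mx mul_delta_mx.
  exact: psdmx_gram.
rewrite /mxtrace (bigD1 k) //= big1 => [|j jk]; last by rewrite mxE (negbTE jk).
by rewrite mxE !eqxx addr0.
Qed.

Lemma psdmx_density (R : realType) (n : nat) (A : 'M[R[i]]_n) : (0 < n)%N ->
  psdmx A -> exists (a : R) (s : 'M[R[i]]_n), [/\ 0 <= a, density s & A = (a%:C)%C *: s].
Proof.
move=> n0 A0; have [U [d [U1 AE d0]]] := psdmx_spectral A0.
have trA : \tr A = \sum_i d 0 i.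
  by rewrite AE -mulmxA mxtrace_mulC -mulmxA U1 mulmx1 mxtrace_diag.
have tr0 : 0 <= \tr A by rewrite trA; exact: sumr_ge0.
have [trA0|trA0] := eqVneq (\tr A) 0.
  (* A vanishing trace forces [A = 0], so any density with weight 0 will do. *)
  exists 0, (delta_mx (Ordinal n0) (Ordinal n0)); split=> //.
    exact: density_delta.
  rewrite AE scale0r; suff -> : d = 0 by rewrite linear0 mulmx0 mul0mx.
  apply/rowP => i; rewrite mxE; apply/eqP; move/eqP: trA0.
  by rewrite trA psumr_eq0 // => /allP/(_ i (mem_index_enum _)).
have [a aE a0] : exists2 a : R, \tr A = (a%:C)%C & 0 <= a.
  by move: tr0; case: (\tr A) => x y; rewrite lecE /= => /andP[/eqP -> x0]; exists x.
have an0 : a != 0 by apply: contra_neq trA0 => a00; rewrite aE a00.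
exists a, ((a^-1%:C)%C *: A); split=> //.
  split; first by apply: psdmxZ; rewrite ?invr_ge0.
  by rewrite linearZ /= aE -rmorphM /= mulVf.
by rewrite scalerA -rmorphM /= mulfV // scale1r.
Qed.

Lemma ip_density1 (R : realType) (n : nat) (s : 'M[R[i]]_n) : density s -> ip s 1%:M = 1.
Proof. by move=> [_ s1]; rewrite /ip mulmx1 s1. Qed.

Lemma test1 (R : realType) (n : nat) : test (1%:M : 'M[R[i]]_n).
Proof. by split; rewrite ?subrr; [exact: psdmx1|exact: psdmx0]. Qed.

Lemma test_convex (R : realType) (n : nat) (T T' : 'M[R[i]]_n) (t u : R) :
  0 <= t -> 0 <= u -> t + u = 1 -> test T -> test T' ->
  test ((t%:C)%C *: T + (u%:C)%C *: T').
Proof.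
move=> t0 u0 tu [T0 T1] [T'0 T'1]; split; first by apply: psdmxD; exact: psdmxZ.
have -> : 1%:M - ((t%:C)%C *: T + (u%:C)%C *: T') =
    (t%:C)%C *: (1%:M - T) + (u%:C)%C *: (1%:M - T').
  by rewrite !scalerBr addrACA -scalerDl -rmorphD /= tu scale1r opprD.
by apply: psdmxD; exact: psdmxZ.
Qed.

Section test_minimax.
(** [F] and [G] stand for [channel_adj N rho] and [channel_adj M rho], which send a test to an
    operator on the jammer system. *)
Variables (R : realType) (n q : nat) (F G : {linear 'M[R[i]]_q -> 'M[R[i]]_n}).
Hypotheses (n0 : (0 < n)%N).
Hypotheses (F0 : forall T, psdmx T -> psdmx (F T)) (G0 : forall T, psdmx T -> psdmx (G T)).

(** Approachability needs a bound uniform in [T]: [H T] lies between 0 and [H 1%:M], and the cross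
    term with [c] is nonpositive. *)
Let ip_shift_le (H : {linear 'M[R[i]]_q -> 'M[R[i]]_n}) (T : 'M[R[i]]_q) (c : R) :
  (forall T, psdmx T -> psdmx (H T)) -> 0 <= c -> test T ->
  let X := H T - (c%:C)%C *: 1%:M in
  X^t* = X /\ ip X X <= ip (H 1%:M) (H 1%:M) + c ^+ 2 * n%:R.
Proof.
move=> H0 c0 [T0 T1] X; have HT0 := H0 _ T0; split.
  rewrite /X linearB map_mxB psdmx_adj //; congr (_ - _).
  rewrite linearZ /= map_mxZ trmx1 map_mx1; congr (_ *: _).
  by apply: geC0_conj; rewrite ler0c.
have := H0 _ T1; rewrite linearB => HT1.
have := ip_psd_ge0 HT0 HT1; have := ip_psd_ge0 (H0 _ (@psdmx1 _ _)) HT1.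
have := ip_psd_ge0 (@psdmx1 _ n) HT0.
rewrite /X !ip_lin ip11 (ipC (H T) 1%:M) (ipC (H 1%:M) (H T)) => le1 le2 le3.
have : 0 <= c * ip 1%:M (H T) by exact: mulr_ge0.
by lra.
Qed.

(** [P] is a convex constraint met exactly by the tests of the oracle, hence by their averages; the
    bounds [eps] and [c] survive only up to [d]. *)
Let test_minimax_approx (P : 'M[R[i]]_q -> Prop) (eps c : R) :
  0 <= eps -> 0 <= c ->
  (forall T T' (t u : R), 0 <= t -> 0 <= u -> t + u = 1 -> P T -> P T' ->
    P ((t%:C)%C *: T + (u%:C)%C *: T')) ->
  (forall s w, density s -> density w -> exists T,
     [/\ test T, P T, ip s (F (1%:M - T)) <= eps & ip w (G T) <= c]) ->
  forall d, 0 < d -> exists T, [/\ test T, P T &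
    forall s, density s -> ip s (F (1%:M - T)) <= eps + d /\ ip s (G T) <= c + d].
Proof.
move=> eps0 c0 Pconv hyp d d0.
(* Densities have trace 1, so pairing them with [X] and [Y] gives the excess of the value over [c]
   and of the error over [eps]. *)
pose K (X Y : 'M[R[i]]_n) := exists T, [/\ test T, P T, X = G T - (c%:C)%C *: 1%:M
  & Y = F (1%:M - T) - (eps%:C)%C *: 1%:M].
pose D := ip (G 1%:M) (G 1%:M) + c ^+ 2 * n%:R + (ip (F 1%:M) (F 1%:M) + eps ^+ 2 * n%:R).
have [] := @approach_density R n K D n0 _ _ _ d d0.
- move=> X Y X' Y' t u t0 u0 tu [T [T1 PT -> ->]] [T' [T'1 PT' -> ->]].
  exists ((t%:C)%C *: T + (u%:C)%C *: T').
  have comb (a : R) (Z Z' : 'M[R[i]]_n) : (t%:C)%C *: (Z - (a%:C)%C *: 1%:M) +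
      (u%:C)%C *: (Z' - (a%:C)%C *: 1%:M) =
      (t%:C)%C *: Z + (u%:C)%C *: Z' - (a%:C)%C *: 1%:M.
    rewrite !scalerBr addrACA -opprD; congr (_ - _).
    by rewrite -scalerDl -rmorphD /= tu scale1r.
  split; [exact: test_convex|exact: Pconv| |].
    by rewrite comb linearD !linearZ.
  rewrite comb -!linearZ -linearD; congr (F _ - _).
  by rewrite !scalerBr addrACA -scalerDl -rmorphD /= tu scale1r -opprD.
- move=> X Y [T [T1 _ -> ->]].
  have [? ?] := ip_shift_le G0 c0 T1.
  have T1' : test (1%:M - T) by case: T1 => ? ?; split; rewrite ?subKr.
  have [? ?] := ip_shift_le F0 eps0 T1'.
  by split; [ | |exact: lerD].
- move=> A B /(psdmx_density n0)[a [w [a0 w1 ->]]] /(psdmx_density n0)[b [s [b0 s1 ->]]].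
  have [T [T1 PT le1 le2]] := hyp _ _ s1 w1.
  exists (G T - (c%:C)%C *: 1%:M), (F (1%:M - T) - (eps%:C)%C *: 1%:M); split.
    by exists T.
  rewrite !ip_lin !ip_density1 // !mulr1.
  have := ler_wpM2l a0 le2; have := ler_wpM2l b0 le1.
  by lra.
move=> X [Y [[T [T1 PT -> ->]]] H]; exists T; split=> // s s1.
by have := H _ s1; rewrite !ip_lin !ip_density1 // !mulr1 => -[]; split; lra.
Qed.

Lemma test_minimax (eps v : R) : 0 <= eps -> 0 <= v ->
  (forall s w, density s -> density w -> forall d, 0 < d -> exists T,
     [/\ test T, ip s (F (1%:M - T)) <= eps & ip w (G T) <= v + d]) ->
  forall d, 0 < d -> exists T, [/\ test T,
    forall s, density s -> ip s (F (1%:M - T)) <= eps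
  & forall w, density w -> ip w (G T) <= v + d].
Proof.
move=> eps0 v0 hyp d d0.
(* One half of [d] is the slack of the oracle; the other pays for the approximation and, if
   [eps > 0], for the mixing. *)
have d20 : 0 < d / 2 by rewrite divr_gt0.
have vd0 : 0 <= v + d / 2 by lra.
have [eps00|epsN0] := eqVneq eps 0.
  (* As every density is below the identity, this single convex condition on a test forces zero
     error against all of them. *)
  pose P T := ip 1%:M (F (1%:M - T)) <= 0.
  have Ple T s : density s -> test T -> P T -> ip s (F (1%:M - T)) <= 0.
    move=> /density_le1 s1 [_ /F0 T1]; rewrite /P.
    by have := ip_psd_ge0 s1 T1; rewrite !ip_lin; lra.
  have [] := @test_minimax_approx P eps (v + d / 2) eps0 vd0 _ _ _ d20.
  - move=> T T' t u t0 u0 tu; rewrite /P => PT PT'.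
    have -> : 1%:M - ((t%:C)%C *: T + (u%:C)%C *: T') =
        (t%:C)%C *: (1%:M - T) + (u%:C)%C *: (1%:M - T').
      by rewrite !scalerBr addrACA -scalerDl -rmorphD /= tu scale1r opprD.
    rewrite linearD !linearZ !ip_lin.
    have := ler_wpM2l t0 PT; have := ler_wpM2l u0 PT'; lra.
  (* The oracle is queried at the maximally mixed state [m] in place of [s]; zero error there is
     [P T] up to the factor [1/n]. *)
  - move=> s w s1 w1; have nn0 : (n%:R : R) != 0 by rewrite pnatr_eq0 -lt0n.
    pose m : 'M[R[i]]_n := ((n%:R^-1 : R)%:C)%C *: 1%:M.
    have m1 : density m.
      split; first by apply: psdmxZ (@psdmx1 _ _); rewrite invr_ge0.
      by rewrite /m linearZ /= mxtrace1 -(rmorph_nat (real_complex R)) -rmorphM /= mulVf.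
    have [T [T1 le1 le2]] := hyp _ _ m1 w1 _ d20.
    have PT : P T.
      move: le1; rewrite eps00 /m ip_lin pmulr_rle0 // invr_gt0.
      by rewrite ltr0n.
    by exists T; split=> //; rewrite eps00; exact: Ple.
  move=> T [T1 PT H]; exists T; split=> //.
    by move=> s s1; rewrite eps00; exact: Ple.
  by move=> w w1; have [_] := H _ w1; lra.
have e0 : 0 < eps by rewrite lt_neqAle eq_sym epsN0.
pose g := ip 1%:M (G 1%:M).
have g0 : 0 <= g by exact: ip_psd_ge0 (@psdmx1 _ _) (G0 (@psdmx1 _ _)).
(* A test violating the error constraint by h is mixed with weight
   z = h / (eps + h) <= h / eps of the identity. *)
pose h := d / 2 / (1 + g / eps).
have geps0 : 0 <= g / eps by rewrite divr_ge0.
have h0 : 0 < h by rewrite divr_gt0 //; lra.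
have hE : h + h * g / eps = d / 2.
  by rewrite /h; field; rewrite !gt_eqF //; lra.
have [] := @test_minimax_approx xpredT eps (v + d / 2) eps0 vd0 _ _ _ h0 => //.
  move=> s w s1 w1; have [T [? ? ?]] := hyp _ _ s1 w1 _ d20; exists T; split=> //.
move=> T [T1 _ H].
pose z := h / (eps + h); pose y := eps / (eps + h).
have eh0 : eps + h != 0 by rewrite gt_eqF //; lra.
have zy : y + z = 1 by rewrite /z /y -mulrDl mulfV.
have z0 : 0 <= z by rewrite divr_ge0 //; lra.
have y0 : 0 <= y by rewrite divr_ge0 //; lra.
exists ((y%:C)%C *: T + (z%:C)%C *: 1%:M); split.
- exact: test_convex (@test1 _ _).
- move=> s s1; have [le1 _] := H _ s1.
  (* Mixing with the identity scales the error by [y], and [y * (eps + h) = eps]. *)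
  have -> : 1%:M - ((y%:C)%C *: T + (z%:C)%C *: 1%:M) = (y%:C)%C *: (1%:M - T).
    have yE : (y%:C)%C *: 1%:M = 1%:M - (z%:C)%C *: 1%:M :> 'M[R[i]]_q.
      by apply/eqP; rewrite eq_sym subr_eq -scalerDl -rmorphD /= zy scale1r.
    by rewrite scalerBr yE opprD [in LHS](addrC (- _)) addrA.
  rewrite linearZ ip_lin; have := ler_wpM2l y0 le1.
  by rewrite {2}/y mulrVK ?unitfE.
- move=> w w1; have [_ le1] := H _ w1.
  rewrite linearD !linearZ !ip_lin.
  have : y * ip w (G T) <= ip w (G T).
    by apply: ler_piMl; [exact: ip_psd_ge0 w1.1 (G0 T1.1)|lra].
  have wg : ip w (G 1%:M) <= g.
    have := ip_psd_ge0 (density_le1 w1) (G0 (@psdmx1 _ _)).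
    by rewrite !ip_lin /g; lra.
  have : z * ip w (G 1%:M) <= z * g by exact: ler_wpM2l.
  have : z * g <= h * g / eps.
    rewrite /z [leRHS]mulrAC; apply: ler_wpM2r => //.
    by apply: ler_wpM2l; [exact: ltW|rewrite lef_pV2 ?posrE //; lra].
  by lra.
Qed.
End test_minimax.

(** * Logarithms and the theorem *)

Section elog.
Variables (R : realType) (c : R).
Hypothesis hc : 1 < c.
Local Open Scope ereal_scope.

(** This adjunction and the next one let [elog c] commute with infima and suprema, the values 0 and
    [+oo] included. *)
Lemma elog_galois (x y : \bar R) : 0 <= x ->
  (y <= elog c x) = (expeR (y * (ln c)%:E) <= x).
Proof.
move=> x0; rewrite /elog lee_pdivlMr ?ln_gt0 // -[LHS]lee_expeR lneK //.
by rewrite in_itv /= x0 leey.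
Qed.

Lemma elog_galoisl (x y : \bar R) : 0 <= x ->
  (elog c x <= y) = (x <= expeR (y * (ln c)%:E)).
Proof.
move=> x0; rewrite /elog lee_pdivrMr ?ln_gt0 // -[LHS]lee_expeR lneK //.
by rewrite in_itv /= x0 leey.
Qed.

Lemma le_elog (x y : \bar R) : 0 <= x -> x <= y -> elog c x <= elog c y.
Proof.
move=> x0 xy; rewrite elog_galois ?(le_trans x0) //.
by rewrite (le_trans _ xy) // -elog_galois.
Qed.

Lemma elog_inf (S : set (\bar R)) : (forall x, S x -> 0 <= x) ->
  ereal_sup [set - elog c x | x in S] = - elog c (ereal_inf S).
Proof.
move=> S0; have i0 : 0 <= ereal_inf S by apply: le_ereal_inf_tmp.
apply/eqP; rewrite eq_le; apply/andP; split.
  apply: ge_ereal_sup => _ [x Sx <-]; rewrite leeN2 le_elog //.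
  exact: ereal_inf_lbound.
rewrite leeNl elog_galois //; apply: le_ereal_inf_tmp => x Sx.
rewrite -elog_galois ?S0 // leeNl; apply: ereal_sup_ubound.
by exists x.
Qed.

(** Nonemptiness gives [0 <= ereal_sup S], as the adjunction requires; the supremum of the empty set
    is [-oo]. *)
Lemma elog_sup (S : set (\bar R)) : (forall x, S x -> 0 <= x) -> S !=set0 ->
  ereal_inf [set - elog c x | x in S] = - elog c (ereal_sup S).
Proof.
move=> S0 [x0 Sx0].
have i0 : 0 <= ereal_sup S by apply: le_trans (S0 _ Sx0) (ereal_sup_ubound Sx0).
apply/eqP; rewrite eq_le; apply/andP; split; last first.
  apply: le_ereal_inf_tmp => _ [x Sx <-]; rewrite leeN2 le_elog ?S0 //.
  exact: ereal_sup_ubound.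
rewrite leeNr elog_galoisl //; apply: ge_ereal_sup => x Sx.
rewrite -elog_galoisl ?S0 // leeNr; apply: ereal_inf_lbound.
by exists x.
Qed.
End elog.

Lemma beta_state_ge0 (R : realType) (n : nat) (eps : R) (rho sigma : 'M[R[i]]_n) :
  psdmx sigma -> (0 <= beta_state eps rho sigma)%E.
Proof.
move=> s0; apply: le_ereal_inf_tmp => _ [T [[T0 _] _] <-].
by rewrite lee_fin; exact: ip_psd_ge0 s0 T0.
Qed.

Lemma ip_channel_adj (R : realType) (a e b : nat)
    (F : {linear 'M[R[i]]_(a * e) -> 'M[R[i]]_b}) (r : nat)
    (rho : 'M[R[i]]_(a * r)) (s : 'M[R[i]]_e) (T : 'M[R[i]]_(b * r)) :
  complex.Re (\tr (channel_out F rho s *m T)) = ip s (channel_adj F rho T).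
Proof. by rewrite /ip mxtrace_channel_adj. Qed.

(** A test feasible against all jammer states is feasible against each, which gives one inequality.
    The other is [test_minimax] for the adjoint maps, with arbitrary slack [d]. *)
Lemma jammer_minimax (R : realType) (a e b r : nat) (eps : R)
    (N M : {linear 'M[R[i]]_(a * e) -> 'M[R[i]]_b}) (rho : 'M[R[i]]_(a * r)) :
  (0 < e)%N -> 0 <= eps -> CP N -> CP M -> density rho ->
  ereal_inf [set x | exists T, [/\ test T, (alpha N rho T <= eps%:E)%E & x = beta M rho T]]
  = ereal_sup [set x | exists sigma omega, [/\ density sigma, density omega &
      x = beta_state eps (channel_out N rho sigma) (channel_out M rho omega)]].
Proof.
move=> e0 eps0 N0 M0 rho1; set V := ereal_sup _.
apply/eqP; rewrite eq_le; apply/andP; split; last first.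
  apply: le_ereal_inf_tmp => _ [T [T1 aT ->]].
  apply: ge_ereal_sup => _ [s [w [s1 w1 ->]]].
  apply: (@le_trans _ _ (complex.Re (\tr (channel_out M rho w *m T)))%:E).
    apply: ereal_inf_lbound; exists T => //; split=> //.
    rewrite -lee_fin; apply: le_trans aT; apply: ereal_sup_ubound.
    by exists s.
  by apply: ereal_sup_ubound; exists w.
have V0 : (0 <= V)%E.
  have d1 := @density_delta R e (Ordinal e0).
  apply: le_trans (ereal_sup_ubound _); last by do 2 eexists; split; [exact: d1|exact: d1|].
  by apply: beta_state_ge0; exact: psdmx_channel_out rho1.1 d1.1.
move: V0; case VE: V => [v| |]; rewrite ?leey // lee_fin => v0.
apply/lee_addgt0Pr => d d0.
have [||s w s1 w1 h h0|T [T1 TN TM]] := @test_minimax R e (b * r)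
    (channel_adj N rho) (channel_adj M rho) e0 _ _ eps v eps0 v0 _ d d0.
- by move=> T; exact: psdmx_channel_adj rho1.1.
- by move=> T; exact: psdmx_channel_adj rho1.1.
(* The slack [h] makes the bound strict, so some feasible test has value below [v + h]. *)
- have : (beta_state eps (channel_out N rho s) (channel_out M rho w) < (v + h)%:E)%E.
    apply: (@le_lt_trans _ _ v%:E); last by rewrite lte_fin ltrDl.
    by rewrite -VE; apply: ereal_sup_ubound; exists s, w.
  move=> /ereal_inf_lt[_ [T [T1 TN] <-]]; rewrite lte_fin => TM.
  by exists T; rewrite -!ip_channel_adj; split=> //; exact: ltW.
apply: le_trans (ereal_inf_lbound _) _; first by exists T; split=> //;
  apply: ge_ereal_sup => _ [s s1 <-]; rewrite lee_fin ip_channel_adj; exact: TN.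
apply: ge_ereal_sup => _ [w w1 <-]; rewrite lee_fin ip_channel_adj; exact: TM.
Qed.

Theorem proposition18 (R : realType) (c : R) (hc : 1 < c)
    (dA dE dB : nat) (hA : (0 < dA)%N) (hE : (0 < dE)%N) (hB : (0 < dB)%N)
    (eps : R) (heps0 : 0 <= eps) (heps1 : eps <= 1)
    (N M : {linear 'M[R[i]]_(dA * dE) -> 'M[R[i]]_dB})
    (hN : CPTP N) (hM : CP M) :
  (- elog c (beta_jammer eps N M))%E = DH_minimax c eps N M.
Proof.
pose S r (rho : 'M[R[i]]_(dA * r)) := [set x | exists sigma omega,
  [/\ density sigma, density omega &
      x = beta_state eps (channel_out N rho sigma) (channel_out M rho omega)]].
have S0 r (rho : 'M[R[i]]_(dA * r)) x : density rho -> S r rho x -> (0 <= x)%E.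
  move=> rho1 [s [w [s1 w1 ->]]]; apply: beta_state_ge0.
  exact: psdmx_channel_out rho1.1 w1.1.
have Sn0 r (rho : 'M[R[i]]_(dA * r)) : S r rho !=set0.
  have d1 := @density_delta R dE (Ordinal hE).
  by eexists; do 2 eexists; split; [exact: d1|exact: d1|].
pose V := [set x | exists r (rho : 'M[R[i]]_(dA * r)), density rho /\ x = ereal_sup (S r rho)].
have V0 x : V x -> (0 <= x)%E.
  move=> [r [rho [rho1 ->]]]; have [y Sy] := Sn0 r rho.
  exact: le_trans (S0 _ _ _ rho1 Sy) (ereal_sup_ubound Sy).
(* The joint infimum is taken over tests first, where [jammer_minimax] applies for each [rho]. *)
have -> : beta_jammer eps N M = ereal_inf V.
  apply/eqP; rewrite eq_le; apply/andP; split; apply: le_ereal_inf_tmp => x.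
    move=> [r [rho [rho1 ->]]].
    rewrite -(jammer_minimax hE heps0 hN.1 hM rho1); apply: le_ereal_inf_tmp => _ [T [T1 aT ->]].
    by apply: ereal_inf_lbound; exists r, rho, T.
  move=> [r [rho [T [rho1 T1 aT ->]]]].
  apply: (@le_trans _ _ (ereal_sup (S r rho))); first by apply: ereal_inf_lbound; exists r, rho.
  rewrite -(jammer_minimax hE heps0 hN.1 hM rho1).
  by apply: ereal_inf_lbound; exists T.
(* As [- elog c] reverses the order, the infimum over [rho] becomes a supremum here, and the
   supremum over jammer states an infimum in [DHE]. *)
rewrite -(elog_inf hc V0) /DH_minimax; congr ereal_sup.
have DHE r (rho : 'M[R[i]]_(dA * r)) : density rho ->
    ereal_inf [set y | exists sigma omega : 'M[R[i]]_dE, [/\ density sigma, density omega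
            & y = DH c eps (channel_out N rho sigma) (channel_out M rho omega)]]
    = (- elog c (ereal_sup (S r rho)))%E.
  move=> rho1; rewrite -(elog_sup hc (fun x => S0 _ _ x rho1) (Sn0 r rho)); congr ereal_inf.
  apply/seteqP; split=> x.
    by move=> [s [w [s1 w1 ->]]]; eexists; first by exists s, w.
  by move=> [_ [s [w [s1 w1 ->]]] <-]; exists s, w.
apply/seteqP; split=> x.
  by move=> [_ [r [rho [rho1 ->]]] <-]; exists r, rho; rewrite DHE.
move=> [r [rho [rho1 ->]]]; rewrite DHE //; exists (ereal_sup (S r rho)) => //.
by exists r, rho.
Qed.
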